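(* Let $d\geq 2$ be a fixed integer. For all positive integers $n$ and $k \leq n^{(d-1)/d}\cdot (5d)^{1/d-2}$, there is a set of $n$ points in $\mathbb{R}^d$ such that every geometric spanner of tree-width $k$ on this set has dilation $\Omega (n/k^{d/(d-1)})$.
   Context: A geometric spanner on a point set $P\subset\mathbb{R}^d$ is a graph $G$ with vertex set $P$ in which each edge is weighted by the Euclidean distance between its endpoints. Its dilation is $\max\{ d_G(p,p')/|pp'| : p\neq p'\in P\}$, where $d_G$ is the shortest-path distance in $G$ and $|pp'|$ the Euclidean distance. Asymptotic notation is with $d$ fixed. *)

(* Defs.v *)
From HB Require Import structures.
From mathcomp Require Import all_boot all_order all_algebra.
From mathcomp Require Import all_classical all_reals all_analysis.
Set Implicit Arguments. Unset Strict Implicit. Unset Printing Implicit Defensive.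
Import Order.TTheory GRing.Theory Num.Theory.
Local Open Scope ring_scope.
Local Open Scope classical_set_scope.

Definition eucl (R : realType) (d : nat) (x y : 'rV[R]_d) : R :=
  Num.sqrt (\sum_(i < d) (x ord0 i - y ord0 i) ^+ 2).

Definition simple_graph (V : finType) (e : rel V) : Prop :=
  symmetric e /\ irreflexive e.

Definition is_tree (T : finType) (e : rel T) : Prop :=
  simple_graph e /\
  (forall x y : T, connect e x y) /\
  (forall c : seq T, uniq c -> (3 <= size c)%N -> ~~ cycle e c).

Definition tree_decomposition (V : finType) (G : rel V)
  (T : finType) (e : rel T) (B : T -> {set V}) : Prop :=
  is_tree e /\
  (forall v : V, exists t : T, v \in B t) /\
  (forall u v : V, G u v -> exists t : T, (u \in B t) && (v \in B t)) /\
  (forall (v : V) (t1 t2 : T), v \in B t1 -> v \in B t2 ->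
      connect [rel x y | [&& e x y, v \in B x & v \in B y]] t1 t2).

Definition treewidth_le (V : finType) (G : rel V) (k : nat) : Prop :=
  exists (T : finType) (e : rel T) (B : T -> {set V}),
    tree_decomposition G e B /\ forall t : T, (#|B t| <= k.+1)%N.

Fixpoint walk_length (R : realType) (d : nat) (V : Type) (P : V -> 'rV[R]_d)
  (x : V) (p : seq V) : R :=
  match p with
  | [::] => 0
  | y :: p' => eucl (P x) (P y) + walk_length P y p'
  end.

(* Shortest-path distance in the geometric graph G (+oo if no path). *)
Definition gdist (R : realType) (d : nat) (V : finType) (P : V -> 'rV[R]_d)
  (G : rel V) (x y : V) : \bar R :=
  ereal_inf [set ((walk_length P x p)%:E) | p in
               [set p : seq V | path G x p /\ last x p = y]].

Definition dilation (R : realType) (d : nat) (V : finType) (P : V -> 'rV[R]_d)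
  (G : rel V) : \bar R :=
  ereal_sup [set (gdist P G xy.1 xy.2 * ((eucl (P xy.1) (P xy.2))^-1)%:E)%E
              | xy in [set xy : V * V | xy.1 <> xy.2]].

(* Main.v *)
Require Import Defs.
From HB Require Import structures.
From mathcomp Require Import all_boot all_order all_algebra.
From mathcomp Require Import all_classical all_reals all_analysis.
From mathcomp Require Import zify ring lra.
Import Order.TTheory GRing.Theory Num.Theory.
Local Open Scope ring_scope.

(** The point set is a [d]-dimensional [m x ... x m] grid, with [m] of order [k^(1/(d-1))],
    whose edges are subdivided into [L] unit steps, with [L] of order
    [n / m^d = n / k^(d/(d-1))].  If a graph on these points has dilation less than [L/2],
    unit neighbours are joined by walks staying within [L/2] of them.  Connect two grid
    vertices [u], [v] by the route that changes one coordinate at a time.  A vertex [z] can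
    only interfere with the [i]-th leg of this route if it determines the coordinates of [v]
    before [i] and those of [u] after [i], so it blocks at most [d m^(d+1)] of the [m^(2d)]
    pairs.  As [2 d (k+1) < m^(d-1)], every bag of size [k+1] therefore leaves more than half
    of the grid vertices in one component of its complement.  These components pairwise meet,
    which no tree decomposition allows: every node of the tree would point to the neighbour
    in whose direction its component lies, two adjacent nodes would point to each other, and
    their components would be disjoint. *)

(** * Walks avoiding a set, and tree decompositions *)

Definition avoid {V : finType} (G : rel V) (X : {set V}) : rel V :=
  [rel a b | [&& G a b, a \notin X & b \notin X]].

Lemma path_avoid (V : finType) (G : rel V) (X : {set V}) (p : seq V) (x : V) :
  path G x p -> all (fun y => y \notin X) (x :: p) -> path (avoid G X) x p.
Proof.
elim: p x => //= y p IH x /andP[Gxy Gp] /and3P[xX yX pX].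
by rewrite {1}/avoid /= Gxy xX yX IH //= yX pX.
Qed.

Lemma avoid_sym (V : finType) (G : rel V) (X : {set V}) :
  symmetric G -> connect_sym (avoid G X).
Proof.
move=> symG; apply: sym_connect_sym => x y; rewrite /avoid /=.
by rewrite symG [(x \notin X) && _]andbC.
Qed.

(** Iterating [f] reaches a periodic point, whose orbit is a simple cycle of [e]. Acyclicity forces
    its length below 3. *)
Lemma exists_2cycle (T : finType) (e : rel T) (f : T -> T) (t0 : T) :
  is_tree e -> (forall t, e t (f t)) -> exists t, f (f t) = t.
Proof.
move=> [[_ irr] [_ acyc]] ef.
have [i lti iterE] := trajectP (looping_order f t0).
set y := iter i f t0 in iterE.
have yP : exists j, iter j.+1 f y = y.
  by exists (order f t0 - i.+1)%N; rewrite -{2}iterE /y -iterD addSnnS subnK.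
have cyc : fcycle f (orbit f y) by apply/(orbitPcycle 3 0).
have ce : cycle e (orbit f y).
  by apply: sub_cycle cyc => a b /eqP <-.
have := contraTN (acyc _ (orbit_uniq f y)) ce.
rewrite size_orbit -ltnNge => ord3.
have iterO : iter (order f y) f y = y by apply/(orbitPcycle 3 4).
exists y; have := order_gt0 f y.
move: (order f y) ord3 iterO => [|[|[|]]] // _ fy _; by [have := ef y; rewrite [f y]fy irr | ].
Qed.

(** Let [f t] be the neighbour of [t] on the path to [r t], and let [t], [t'] be swapped by [f]. A
    common [x] is then reached from [t'] avoiding [t] and from [t] avoiding [t'], so together with
    the edge between them a cycle closes. *)
Lemma tree_no_escape (T : finType) (e : rel T) (t0 : T) (r : T -> T) :
  is_tree e -> (forall t, r t != t) ->
  ~ (forall s t, exists x, connect (avoid e [set s]) (r s) x /\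
                           connect (avoid e [set t]) (r t) x).
Proof.
move=> tree rt meet; have [[sym irr] [conn acyc]] := tree.
have /choice[f fP] : forall t, exists s, e t s /\ connect (avoid e [set t]) s (r t).
  move=> t; have /connectP[p0 ep0 lp0] := conn t (r t).
  have := rt t; rewrite lp0; case: (shortenP ep0) => -[|s q]; first by rewrite eqxx.
  move=> /= /andP[ets eq] /andP[tq _] _ _; exists s; split=> //.
  apply/connectP; exists q => //; apply: path_avoid => //.
  apply/allP => y yq; rewrite inE; apply: contraNneq tq => <-; exact: yq.
have [t fft] := exists_2cycle _ _ _ t0 tree (fun t => (fP t).1).
set t' := f t in fft.
have ett' : e t t' := (fP t).1.
(* [e'] is the tree with the edge between [t] and [t'] deleted; a walk avoiding either endpoint
   survives in it. *)
pose e' := [rel a b | [&& e a b, (a, b) != (t, t') & (a, b) != (t', t)]].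
have sub s : s \in [:: t; t'] -> subrel (avoid e [set s]) (connect e').
  move=> st a b /= /and3P[eab]; rewrite !inE => an bn; apply: connect1.
  rewrite /= eab !xpair_eqE.
  by move: st; rewrite !inE => /orP[] /eqP E; subst s; rewrite (negPf an) (negPf bn) /= ?andbF.
have sym' : connect_sym e'.
  apply: sym_connect_sym => a b /=; rewrite sym !xpair_eqE; congr andb.
  by rewrite andbC [(a == t') && _]andbC [(a == t) && _]andbC.
have [x [xt xt']] := meet t t'.
have ct : connect e' t' x.
  have H : connect (avoid e [set t]) t' x by apply: connect_trans xt; exact: (fP t).2.
  by apply: (connect_sub (sub t _)) H; rewrite inE eqxx.
have ct' : connect e' t x.
  have H : connect (avoid e [set t']) t x.
    by apply: connect_trans xt'; have := (fP t').2; rewrite fft.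
  by apply: (connect_sub (sub t' _)) H; rewrite !inE eqxx orbT.
have /connectP[p0 ep0 lp0] : connect e' t t' by apply: connect_trans ct' _; rewrite sym'.
have nett' : t != t' by apply/eqP => E; move: ett'; rewrite -E irr.
case: (shortenP ep0) lp0 => p ep up _ lp.
have ce : cycle e (t :: p).
  rewrite /= rcons_path -lp sym ett' andbT.
  by apply: sub_path ep => a b /= /andP[].
(* The cycle has at least 3 vertices: [p] is nonempty as [t != t'], and a single step would use the
   deleted edge. *)
have := contraTN (acyc _ up) ce; case: p ep up lp {ce} => [_ _ E|a [|b p]] //=.
  by rewrite E eqxx in nett'.
by move=> + _ E; rewrite -E !eqxx andbF.
Qed.

(** Consecutive vertices of a walk share a bag, and the bags of a vertex outside [B t] form a
    subtree missing [t]. Hence all bags met by the component of [u t] lie on one side of [t], and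
    meeting components would contradict [tree_no_escape]. *)
Lemma treewidth_no_haven (V T : finType) (G : rel V) (e : rel T) (B : T -> {set V})
    (v0 : V) (u : T -> V) :
  tree_decomposition G e B -> (forall t, u t \notin B t) ->
  ~ (forall s t, exists z, connect (avoid G (B s)) (u s) z /\
                           connect (avoid G (B t)) (u t) z).
Proof.
move=> [tree [cov [edg sub]]] uB meet.
have [t0 _] := cov v0.
have /choice[r rP] : forall t, exists r, u t \in B r by move=> t; exact: cov.
have subtree t v s1 s2 : v \notin B t -> v \in B s1 -> v \in B s2 ->
    connect (avoid e [set t]) s1 s2.
  move=> vt v1 v2; apply: connect_sub (sub v s1 s2 v1 v2) => a b /= /and3P[eab va vb].
  apply: connect1; rewrite /avoid /= eab !inE.
  by rewrite !(contraNneq _ vt) // => <-.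
have reach t z s : connect (avoid G (B t)) (u t) z -> z \in B s ->
    connect (avoid e [set t]) (r t) s.
  move=> /connectP[p + ->] {z}.
  elim/last_ind: p s => [|p z IH] s /=; first by move=> _; apply: subtree (rP t).
  rewrite rcons_path last_rcons => /andP[pp /= /and3P[Gz lB zB]] zs.
  have [s' /andP[ls' zs']] := edg _ _ Gz.
  exact: connect_trans (IH s' pp ls') (subtree _ _ _ _ zB zs' zs).
apply: (tree_no_escape _ e t0 r tree).
  by move=> t; apply: contraNneq (uB t) => E; rewrite -{2}E.
move=> s t; have [z [zs zt]] := meet s t; have [x zx] := cov z.
by exists x; split; [apply: reach zs zx|apply: reach zt zx].
Qed.

(** * Counting pairs of grid vertices *)

Lemma card_bigcup_le (I T : finType) (A : {pred I}) (F : I -> {set T}) (c : nat) :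
  (forall i, (#|F i| <= c)%N) -> (#|\bigcup_(i in A) F i| <= #|A| * c)%N.
Proof.
move=> Fc; rewrite -sum_nat_const.
elim/big_ind2: _ => [|A1 n1 A2 n2 h1 h2|i _]; rewrite ?cards0 //.
by apply: leq_trans (leq_add h1 h2); rewrite leq_card_setU.
Qed.

Lemma exists_majority_row (F : finType) (bad : {set F * F}) :
  (#|bad| * 2 < #|F| * #|F|)%N ->
  exists u, (#|F| < #|[set v | (u, v) \notin bad]| * 2)%N.
Proof.
move=> badlt; apply/existsP; apply: contraLR badlt; rewrite -leqNgt => /existsPn H.
have cardE (A : {set F * F}) : #|A| = (\sum_u #|[set v | (u, v) \in A]|)%N.
  rewrite -sum1_card (eq_bigl (fun p : F * F => true && ((p.1, p.2) \in A))); last by case.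
  rewrite -(pair_big_dep xpredT (fun i j => (i, j) \in A) (fun _ _ => 1%N)) /=.
  by apply: eq_bigr => u _; rewrite sum1dep_card.
have : (#|~: bad| * 2 <= #|F| * #|F|)%N.
  rewrite cardE big_distrl /= -sum_nat_const; apply: leq_sum => u _.
  have := H u; rewrite -leqNgt; congr (_ * _ <= _)%N.
  by apply: eq_card => v; rewrite !inE.
have := cardsC bad; rewrite card_prod => <-.
by rewrite addnC muln2 -addnn leq_add2l muln2 -addnn leq_add2r.
Qed.

(** The corner of the route from [u] to [v] at which leg [i] starts. *)
Definition hybrid {d m : nat} (u v : {ffun 'I_d -> 'I_m}) (i : nat) : {ffun 'I_d -> 'I_m} :=
  [ffun j : 'I_d => if (j < i)%N then v j else u j].

Lemma card_hybrid_line (d m : nat) (i : 'I_d) (Q : 'I_d -> 'I_m -> bool) :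
  (forall j a b, Q j a -> Q j b -> a = b) ->
  (#|[set uv : {ffun 'I_d -> 'I_m} * {ffun 'I_d -> 'I_m} |
       [forall (j | j != i), Q j (hybrid uv.1 uv.2 i j)]]| <= m ^ d.+1)%N.
Proof.
move=> Q1; set A := [set _ | _].
(* On [A], [u] is determined after [i] and [v] before [i]; the remaining coordinates are
   [u j] for [j <= i], [v j] for [j > i], and [v i]. *)
pose g (uv : {ffun 'I_d -> 'I_m} * {ffun 'I_d -> 'I_m}) := (hybrid uv.2 uv.1 i.+1, uv.2 i).
rewrite -(_ : #|(predT : {pred {ffun 'I_d -> 'I_m} * 'I_m})| = (m ^ d.+1)%N); last first.
  by rewrite card_prod card_ffun !card_ord expnSr.
rewrite -(card_in_imset (f := g)); first exact: max_card.
move=> [u v] [u' v']; rewrite !inE /= => /forallP H /forallP H' [] E Ei.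
have {}E (j : 'I_d) : (if (j < i.+1)%N then u j else v j) = (if (j < i.+1)%N then u' j else v' j).
  by move/ffunP/(_ j): E; rewrite !ffunE.
have Hj (j : 'I_d) : j != i -> (if (j < i)%N then v j else u j) = (if (j < i)%N then v' j else u' j).
  move=> ji; move: (H j) (H' j); rewrite ji /= !ffunE => ? ?; exact: (Q1 j).
congr pair; apply/ffunP => j; move: (E j) (Hj j); rewrite ltnS -val_eqE /=.
  by case: ltngtP => //= ji h1 h2; apply: h2.
case: ltngtP => [ji _|ji|/val_inj ->] //=; by move=> h; apply: h.
Qed.

(** * Walk lengths, coordinates and dilation *)

Lemma coord_le_eucl (R : realType) (d : nat) (x y : 'rV[R]_d) (j : 'I_d) :
  `|x ord0 j - y ord0 j| <= eucl x y.
Proof.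
rewrite /eucl -sqrtr_sqr ler_wsqrtr // (bigD1 j) //= lerDl.
by apply: sumr_ge0 => i _; exact: sqr_ge0.
Qed.

Lemma walk_length_ge0 (R : realType) (d : nat) (V : Type) (P : V -> 'rV[R]_d) (x : V) p :
  0 <= walk_length P x p.
Proof. by elim: p x => //= y p IH x; rewrite addr_ge0 ?IH // sqrtr_ge0. Qed.

Lemma coord_le_walk_length (R : realType) (d : nat) (V : eqType) (P : V -> 'rV[R]_d)
    (x z : V) (p : seq V) (j : 'I_d) :
  z \in x :: p -> `|P z ord0 j - P x ord0 j| <= walk_length P x p.
Proof.
elim: p x => [|y p IH] x; first by rewrite inE => /eqP ->; rewrite subrr normr0.
rewrite inE => /orP[/eqP ->|zp]; first by rewrite subrr normr0 walk_length_ge0.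
rewrite /= [leRHS]addrC; apply: le_trans (ler_distD (P y ord0 j) _ _) _.
by rewrite lerD ?IH // distrC coord_le_eucl.
Qed.

Lemma dilation_walk (R : realType) (d : nat) (V : finType) (P : V -> 'rV[R]_d) (G : rel V)
    (D : R) (a b : V) :
  (dilation P G < D%:E)%E -> eucl (P a) (P b) = 1 ->
  exists p, [/\ path G a p, last a p = b & walk_length P a p < D].
Proof.
move=> dil ab1.
have ab : a <> b.
  move=> E; move: ab1; rewrite E /eucl big1 ?sqrtr0 => [/eqP|i _].
    by rewrite eq_sym oner_eq0.
  by rewrite subrr expr0n.
have : (gdist P G a b < D%:E)%E.
  apply: le_lt_trans dil; apply: ereal_sup_ubound; exists (a, b) => //=.
  by rewrite ab1 invr1 mule1.
by move=> /ereal_inf_lt[_ [p [pp lp] <-]]; rewrite lte_fin; exists p.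
Qed.

Lemma dilation_ge1 (R : realType) (d : nat) (V : finType) (P : V -> 'rV[R]_d) (G : rel V)
    (a b : V) (j : 'I_d) :
  eucl (P a) (P b) = 1 -> `|P a ord0 j - P b ord0 j| = 1 -> (1%:E <= dilation P G)%E.
Proof.
move=> ab1 abj; rewrite leNgt; apply/negP => /dilation_walk/(_ ab1)[p [_ lp]].
by apply/negP; rewrite -leNgt -abj distrC; apply: coord_le_walk_length; rewrite -lp mem_last.
Qed.

(** No coordinate can change by [D] along a walk shorter than [D], so the walk never reaches [X]. *)
Lemma avoid_short_walk (R : realType) (d : nat) (V : finType) (P : V -> 'rV[R]_d) (G : rel V)
    (X : {set V}) (D : R) (a : V) (p : seq V) :
  path G a p -> walk_length P a p < D ->
  (forall z, z \in X -> exists j, D <= `|P z ord0 j - P a ord0 j|) ->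
  connect (avoid G X) a (last a p).
Proof.
move=> Gp pD far; apply/connectP; exists p => //; apply: path_avoid => //.
apply/allP => z zp; apply/negP => /far[j]; apply/negP; rewrite -ltNge.
exact: le_lt_trans (coord_le_walk_length _ _ _ _ _ _ _ _ zp) pD.
Qed.

(** * The point set: a subdivided grid *)

Definition line_point {R : realType} {d m : nat} (L : nat) (i : 'I_d)
    (w : {ffun 'I_d -> 'I_m}) (t : nat) : 'rV[R]_d :=
  \row_j (if j == i then t%:R else (L * w j)%:R).

Lemma eucl_line_point (R : realType) (d m L : nat) (i : 'I_d) (w : {ffun 'I_d -> 'I_m}) (s t : nat) :
  eucl (line_point L i w s : 'rV[R]_d) (line_point L i w t) = `|s%:R - t%:R|.
Proof.
rewrite /eucl (bigD1 i) //= big1 ?addr0 => [|j ji]; last by rewrite !mxE (negPf ji) subrr expr0n.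
by rewrite !mxE eqxx sqrtr_sqr.
Qed.

(** Each of the [m ^ d] grid vertices starts a segment of [L] points in each of the [d] directions.
    Vertices arise once per direction, whence the [undup]. *)
Lemma exists_grid_points (R : realType) (d m L n : nat) : (0 < d)%N -> (d * m ^ d * L <= n)%N ->
  exists P : 'I_n -> 'rV[R]_d, injective P /\
    forall (i : 'I_d) (w : {ffun 'I_d -> 'I_m}) (t : nat), (t < m * L)%N ->
      exists a, P a = line_point L i w t.
Proof.
case: d => // d _ le_n.
pose pos (x : 'I_d.+1 * {ffun 'I_d.+1 -> 'I_m} * 'I_L) : 'rV[R]_d.+1 :=
  line_point L x.1.1 x.1.2 (x.1.2 x.1.1 * L + x.2).
pose S0 := undup [seq pos x | x in predT].
(* Filler points bringing the total number to exactly [n]. *)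
pose far (t : nat) : 'rV[R]_d.+1 := \row_j (- t.+1%:R).
pose S := S0 ++ [seq far t | t <- iota 0 (n - size S0)].
have sz0 : (size S0 <= n)%N.
  apply: leq_trans (size_undup _) _; rewrite size_map -cardE.
  by rewrite !card_prod card_ffun !card_ord.
have sz : size S = n by rewrite size_cat size_map size_iota subnKC.
have uS : uniq S.
  rewrite cat_uniq undup_uniq /= map_inj_uniq ?iota_uniq ?andbT; last first.
    by move=> s t /rowP/(_ ord0); rewrite !mxE => /oppr_inj/eqP; rewrite eqr_nat => /eqP[].
  apply/hasPn => _ /mapP[t _ ->]; rewrite mem_undup; apply/negP => /mapP[x _].
  move=> /rowP/(_ ord0); rewrite !mxE => E.
  have : - t.+1%:R < 0 :> R by rewrite oppr_lt0 ltr0n.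
  by rewrite E; case: ifP => _; rewrite ltrn0.
exists (fun a => nth 0 S a); split.
  by move=> a b /eqP; rewrite nth_uniq ?sz // => /eqP/val_inj.
move=> i w t lt_t.
have L0 : (0 < L)%N by case: L lt_t {le_n pos S0 S sz0 sz uS} => //; rewrite muln0.
have qm : (t %/ L < m)%N by rewrite ltn_divLR.
(* The segment containing height [t] starts at the grid vertex whose coordinate [i] is the quotient
   of [t] by [L]. *)
pose w' := [ffun j => if j == i then Ordinal qm else w j].
have inS : line_point L i w t \in S.
  rewrite mem_cat mem_undup; apply/orP; left.
  apply/mapP; exists (i, w', Ordinal (ltn_pmod t L0)); first by rewrite mem_enum.
  apply/rowP => j; rewrite !mxE /= !ffunE eqxx /= -divn_eq.
  by case: eqP.
have lt_n : (index (line_point L i w t) S < n)%N by rewrite -sz index_mem.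
by exists (Ordinal lt_n); rewrite /= nth_index.
Qed.

(** * Routing through the grid and large components *)

Section GridPoints.
Context (R : realType) (d m L n : nat) (P : 'I_n -> 'rV[R]_d) (D : R) (G : rel 'I_n).
Hypotheses (P_inj : injective P) (sG : symmetric G).
Hypothesis P_line : forall (i : 'I_d) (w : {ffun 'I_d -> 'I_m}) (t : nat), (t < m * L)%N ->
  exists a, P a = line_point L i w t.
Hypotheses (dilG : (dilation P G < D%:E)%E) (D_gt0 : 0 < D) (DL : D <= L%:R / 2).

(** Unit steps along the line keep every coordinate but [i] fixed, so one far coordinate [j != i]
    keeps [z] off the walks that replace all of these steps. *)
Lemma connect_line (X : {set 'I_n}) (i : 'I_d) (w : {ffun 'I_d -> 'I_m}) (s t : nat) (a b : 'I_n) :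
  (forall z, z \in X -> exists j, j != i /\ D <= `|P z ord0 j - (L * w j)%:R|) ->
  (s < m * L)%N -> (t < m * L)%N ->
  P a = line_point L i w s -> P b = line_point L i w t -> connect (avoid G X) a b.
Proof.
move=> free sm tm Pa Pb.
have [c0 Pc0] := P_line i w 0 (leq_ltn_trans (leq0n _) sm).
suff main : forall r c, (r < m * L)%N -> P c = line_point L i w r -> connect (avoid G X) c0 c.
  apply: connect_trans (main t b tm Pb); rewrite (avoid_sym _ _ _ sG).
  exact: main Pa.
move=> r; elim: r => [|r IH] c rm Pc; first by rewrite (P_inj _ _ (etrans Pc (esym Pc0))).
have [c' Pc'] := P_line i w r (ltnW rm).
apply: connect_trans (IH c' (ltnW rm) Pc') _.
have c1 : eucl (P c') (P c) = 1.
  by rewrite Pc Pc' eucl_line_point -[r.+1]addn1 natrD opprD addNKr normrN normr1.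
have [p [Gp <- pD]] := dilation_walk _ _ _ _ _ _ _ _ dilG c1.
apply: avoid_short_walk Gp pD _ => z /free[j [ji far]].
by exists j; rewrite Pc' mxE (negPf ji).
Qed.

Lemma grid_vertex_line (w : {ffun 'I_d -> 'I_m}) (i : 'I_d) :
  \row_j (L * w j)%:R = line_point L i w (L * w i) :> 'rV[R]_d.
Proof. by apply/rowP => j; rewrite !mxE; case: eqP => [->|]. Qed.

Lemma line_height_lt (w : {ffun 'I_d -> 'I_m}) (i : 'I_d) : (0 < L)%N -> (L * w i < m * L)%N.
Proof. by move=> L0; rewrite mulnC ltn_pmul2r. Qed.

Context (gv : {ffun 'I_d -> 'I_m} -> 'I_n).
Hypotheses (gvP : forall w, P (gv w) = \row_j (L * w j)%:R) (L_gt0 : (0 < L)%N).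

(** Coordinate [i] is left free: [z] may interfere anywhere along the line carrying leg [i]. *)
Definition hits (z : 'I_n) (i : 'I_d) (u v : {ffun 'I_d -> 'I_m}) : bool :=
  [forall (j | j != i), `|P z ord0 j - (L * hybrid u v i j)%:R| < D].

Lemma connect_route (X : {set 'I_n}) (u v : {ffun 'I_d -> 'I_m}) :
  (forall z i, z \in X -> ~~ hits z i u v) -> connect (avoid G X) (gv u) (gv v).
Proof.
move=> free.
suff main i : (i <= d)%N -> connect (avoid G X) (gv u) (gv (hybrid u v i)).
  have -> : v = hybrid u v d by apply/ffunP => j; rewrite ffunE ltn_ord.
  exact: main.
elim: i => [_|i IH lt_i].
  by rewrite (_ : hybrid u v 0 = u) //; apply/ffunP => j; rewrite ffunE.
apply: connect_trans (IH (ltnW lt_i)) _.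
pose io := Ordinal lt_i.
apply: (connect_line X io (hybrid u v i) (L * u io) (L * v io)).
- move=> z /(free z io); rewrite negb_forall_in => /exists_inP[j ji].
  by rewrite -leNgt => far; exists j.
- exact: line_height_lt.
- exact: line_height_lt.
- by rewrite gvP (grid_vertex_line _ io) ffunE ltnn.
- rewrite gvP; apply/rowP => j; rewrite !mxE !ffunE ltnS.
  have [->|ji] := eqVneq j io; first by rewrite leqnn.
  by rewrite leq_eqVlt -[(_ == _ :> nat)]/(j == io) (negPf ji).
Qed.

(** Since [D <= L / 2], two multiples of [L] within [D] of the same number coincide, so [z]
    determines each coordinate other than [i] of the corner. *)
Lemma card_hits (z : 'I_n) (i : 'I_d) :
  (#|[set uv | hits z i uv.1 uv.2]| <= m ^ d.+1)%N.
Proof.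
apply: (card_hybrid_line _ _ _ (fun j a => `|P z ord0 j - (L * a)%:R| < D)) => j a b /= Ha Hb.
apply/val_inj/eqP; rewrite -(eqn_pmul2l L_gt0); apply/eqP.
have {Ha Hb} : `|(L * a)%:R - (L * b)%:R| < L%:R :> R.
  apply: le_lt_trans (ler_distD (P z ord0 j) _ _) _.
  by rewrite distrC; have := ltrD Ha Hb; move: DL; lra.
rewrite !natrM -mulrBr normrM normr_nat -{2}[L%:R]mulr1 ltr_pM2l ?ltr0n // => lt1.
congr (_ * _)%N; apply/eqP; rewrite eqn_leq -(ltnS a) -(ltnS b) -!(ltr_nat R) -(natr1 a) -(natr1 b).
by move: lt1; rewrite ltr_norml => /andP[h1 h2]; apply/andP; split; lra.
Qed.

Lemma exists_majority_component (k : nat) (X : {set 'I_n}) :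
  (2 * d * k < m ^ d.-1)%N -> (1 < d)%N -> (#|X| <= k)%N ->
  exists u, gv u \notin X /\
    (m ^ d < #|[set v | connect (avoid G X) (gv u) (gv v)]| * 2)%N.
Proof.
move=> lt_m d1 Xk.
pose bad := \bigcup_(z in X) \bigcup_(i in 'I_d) [set uv | hits z i uv.1 uv.2].
have cF : #|{: {ffun 'I_d -> 'I_m}}| = (m ^ d)%N by rewrite card_ffun !card_ord.
have m0 : (0 < m)%N by rewrite lt0n; apply: contraTneq lt_m => ->; rewrite exp0n //; lia.
have d0 := ltnW d1.
case: (exists_majority_row _ bad) => [|u].
  rewrite cF.
  have : (#|bad| <= k * (d * m ^ d.+1))%N.
    apply: leq_trans (leq_mul Xk (leqnn _)).
    apply: card_bigcup_le => z; rewrite -[X in (_ <= X * _)%N](card_ord d).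
    by apply: card_bigcup_le => i; exact: card_hits.
  move=> badle; apply: leq_ltn_trans (leq_mul badle (leqnn 2)) _.
  have -> : (k * (d * m ^ d.+1) * 2 = (2 * d * k) * m ^ d.+1)%N by lia.
  have -> : (m ^ d * m ^ d = m ^ d.-1 * m ^ d.+1)%N by rewrite -!expnD; congr (_ ^ _)%N; lia.
  by rewrite ltn_pmul2r // expn_gt0 m0.
rewrite cF => big.
have good v : (u, v) \notin bad -> forall z i, z \in X -> ~~ hits z i u v.
  move=> uvb z i zX; apply: contra uvb => h; apply/bigcupP; exists z => //.
  by apply/bigcupP; exists i => //; rewrite inE.
exists u; split; last first.
  apply: leq_trans big _; rewrite leq_mul2r /=; apply: subset_leq_card.
  by apply/fintype.subsetP => v; rewrite !inE => /good; exact: connect_route.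
have : (0 < #|[set v | (u, v) \notin bad]|)%N.
  by rewrite lt0n; apply: contraTneq big => ->; rewrite mul0n.
move=> /card_gt0P[v]; rewrite inE => /good free.
(* Leg 0 starts at [u] itself, so [gv u] in [X] would hit it. *)
apply/negP => uX; have := free (gv u) (Ordinal d0) uX.
rewrite negb_forall_in => /exists_inP[j ji].
by rewrite gvP mxE ffunE /= subrr normr0 D_gt0.
Qed.

Lemma grid_treewidth (k : nat) : (2 * d * k.+1 < m ^ d.-1)%N -> (1 < d)%N ->
  ~ treewidth_le G k.
Proof.
move=> lt_m d1 [T [e [B [dec Bk]]]].
have /choice[u uP] t := exists_majority_component k.+1 (B t) lt_m d1 (Bk t).
have m0 : (0 < m)%N by rewrite lt0n; apply: contraTneq lt_m => ->; rewrite exp0n //; lia.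
apply: (treewidth_no_haven _ _ _ _ _ (gv [ffun _ => Ordinal m0]) (gv \o u) dec) => [t|s t] /=.
  exact: (uP t).1.
set As := [set v | connect (avoid G (B s)) (gv (u s)) (gv v)].
set At := [set v | connect (avoid G (B t)) (gv (u t)) (gv v)].
have : (0 < #|As :&: At|)%N.
  (* Each component contains more than half of the grid vertices, so any two intersect. *)
  have := (uP s).2; have := (uP t).2; rewrite -/As -/At.
  have := cardsUI As At; have := max_card (As :|: At).
  by rewrite card_ffun !card_ord; lia.
move=> /card_gt0P[v]; rewrite !inE => /andP[vs vt]; by exists (gv v).
Qed.

End GridPoints.

(** * Choice of parameters *)

Lemma exists_grid_width (R : realType) (d : nat) (a : R) : (2 <= d)%N -> 1 <= a ->
  exists m : nat, 4 * d%:R * a ^+ d.-1 < (m ^ d.-1)%:R /\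
                  (d * m ^ d)%:R <= d%:R * (5 * d)%:R ^+ d * a ^+ d.
Proof.
move=> d2 a1; have dR : 2 <= d%:R :> R by rewrite ler_nat.
have x0 : 0 <= 4 * d%:R * a by nra.
pose m := (Num.truncn (4 * d%:R * a)).+1; exists m.
have mgt : 4 * d%:R * a < m%:R by exact: truncnS_gt.
have mle : m%:R <= (5 * d)%:R * a.
  have := truncn_le (4 * d%:R * a); rewrite x0 /m -natr1 natrM; nra.
split; last first.
  rewrite natrM natrX -mulrA ler_pM2l ?ltr0n; last by lia.
  by rewrite -exprMn lerXn2r // nnegrE; nra.
have d1 : (0 < d.-1)%N by lia.
apply: (@le_lt_trans _ _ ((4 * d%:R * a) ^+ d.-1)); last first.
  by rewrite natrX ltrXn2r //; lia.
rewrite exprMn ler_wpM2r ?exprn_ge0 //; first by nra.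
by rewrite -[leLHS]expr1 ler_weXn2l //; nra.
Qed.

Lemma powR_root_exprn (R : realType) (x : R) (p q : nat) : 0 <= x ->
  (x `^ (p%:R^-1)) ^+ q = x `^ (q%:R / p%:R).
Proof. by move=> x0; rewrite -powR_mulrn ?powR_ge0 // -powRrM mulrC. Qed.

(** The exponent [1/d - 2] is below -1, so for [n = 1] the right side is below 1. *)
Lemma not_le1_of_bound (R : realType) (d n k : nat) : (2 <= d)%N -> (0 < n)%N -> (0 < k)%N ->
  (k%:R <= (n%:R `^ ((d - 1)%:R / d%:R)) * ((5 * d)%:R `^ (d%:R^-1 - 2)) :> R) -> (1 < n)%N.
Proof.
move=> d2 n0 k0 kle; rewrite ltn_neqAle n0 andbT; apply/eqP => n1.
move: kle; rewrite -n1 powR1 mul1r leNgt => /negP; apply.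
apply: (@lt_le_trans _ _ 1); last by rewrite ler1n.
have d5 : 1 < (5 * d)%:R :> R by rewrite ltr1n; lia.
apply: (@le_lt_trans _ _ ((5 * d)%:R `^ (-1))).
  apply: ler_powR; first exact: ltW.
  have : d%:R^-1 <= 1 :> R by rewrite invf_le1 ?ltr0n ?ler1n //; lia.
  lra.
by rewrite powR_inv1 ?ler0n // invf_lt1 //; lra.
Qed.

Theorem theorem2 (R : realType) (d : nat) (hd : (2 <= d)%N) :
  exists c : R, 0 < c /\
  forall n k : nat, (0 < n)%N -> (0 < k)%N ->
    (k%:R <= (n%:R `^ ((d - 1)%:R / d%:R)) * ((5 * d)%:R `^ (d%:R^-1 - 2)) :> R) ->
    exists P : 'I_n -> 'rV[R]_d, injective P /\
      forall G : rel 'I_n, simple_graph G -> treewidth_le G k ->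
        ((c * n%:R / (k%:R `^ (d%:R / (d - 1)%:R)))%:E <= dilation P G)%E.
Proof.
have d0 : (0 < d)%N by lia.
(* As [d m^d <= d (5d)^d a^d], this [c] makes [D] at most a quarter of [n / (d m^d)], hence less
   than [(L + 1) / 4]. *)
pose c : R := (4 * (d%:R * (5 * d)%:R ^+ d))^-1.
have K0 : 0 < d%:R * (5 * d)%:R ^+ d :> R by rewrite mulr_gt0 ?exprn_gt0 // ltr0n; lia.
have c0 : 0 < c by rewrite invr_gt0; lra.
exists c; split=> // n k n0 k0 kle.
have n1 := not_le1_of_bound _ _ _ _ hd n0 k0 kle.
pose a : R := k%:R `^ ((d - 1)%:R^-1).
have a1 : 1 <= a by rewrite -(powRr0 k%:R) ler_powR ?ler1n ?invr_ge0.
have aE : a ^+ d.-1 = k%:R.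
  by rewrite powR_root_exprn // -subn1 divff ?powRr1 // pnatr_eq0; lia.
rewrite -powR_root_exprn // -/a.
have [m [lt_m le_m]] := exists_grid_width R d a hd a1.
have m0 : (0 < m)%N.
  move: lt_m; case: m {le_m} => // /lt_geF; rewrite exp0n ?ler_wpM2l; last by lia.
  by rewrite aE mulr_ge0 // mulr_ge0.
(* The factor 4 in the width absorbs [k + 1 <= 2 k]. *)
have {lt_m} lt_m : (2 * d * k.+1 < m ^ d.-1)%N.
  by move: lt_m; rewrite aE -!natrM ltr_nat; nia.
have M0 : (0 < d * m ^ d)%N by rewrite muln_gt0 d0 expn_gt0 m0.
pose L := (n %/ (d * m ^ d))%N; pose D := c * n%:R / a ^+ d.
have ad0 : 0 < a ^+ d by rewrite exprn_gt0 //; lra.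
have D0 : 0 < D by rewrite divr_gt0 ?mulr_gt0 ?ltr0n.
have DL : D < L.+1%:R / 4.
  have Ka0 := mulr_gt0 K0 ad0.
  have -> : D = n%:R / (4 * (d%:R * (5 * d)%:R ^+ d * a ^+ d)).
    by rewrite /D /c; field; apply/and3P; split; rewrite lt0r_neq0 // ?exprn_gt0 // ltr0n ?muln_gt0.
  have nlt : n%:R < L.+1%:R * (d * m ^ d)%:R :> R by rewrite -natrM ltr_nat -ltn_divLR.
  rewrite ltr_pdivrMr; last by lra.
  apply: lt_le_trans nlt _.
  have -> (x y : R) : x / 4 * (4 * y) = x * y by field.
  by rewrite ler_wpM2l.
have [L0|L0] := posnP L.
  (* Here [D < 1], and any two points at distance 1 force dilation at least 1. *)
  pose i0 := Ordinal d0; pose w : {ffun 'I_d -> 'I_1} := [ffun => ord0].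
  exists (fun i : 'I_n => line_point 0 i0 w i); split.
    move=> i j /rowP/(_ i0); rewrite !mxE eqxx => /eqP; rewrite eqr_nat => /eqP.
    exact: val_inj.
  move=> G _ _; apply: (@le_trans _ _ 1%:E).
    by rewrite lee_fin ltW //; move: DL; rewrite L0 /D; lra.
  apply: (dilation_ge1 _ _ _ _ _ (Ordinal n0) (Ordinal n1) i0).
    by rewrite eucl_line_point /= sub0r normrN normr1.
  by rewrite !mxE eqxx /= sub0r normrN normr1.
have [P [Pinj Pline]] := exists_grid_points R d m L n d0 (etrans (f_equal (leq^~ n) (mulnC _ _)) (leq_divM _ _)).
exists P; split=> // G [sG _] tw; rewrite leNgt; apply/negP => dil.
(* For [L >= 1], [(L + 1) / 4 <= L / 2]. *)
have DL2 : D <= L%:R / 2.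
  by have : 1 <= L%:R :> R by [rewrite ler1n|]; move: DL; rewrite -natr1; lra.
have /choice[gv gvP] (w : {ffun 'I_d -> 'I_m}) : exists x, P x = \row_j (L * w j)%:R.
  by rewrite (grid_vertex_line R d m L w (Ordinal d0)); apply: Pline; exact: line_height_lt.
by apply: (grid_treewidth R d m L n P D G Pinj sG Pline dil D0 DL2 gv gvP L0 k lt_m hd).
Qed.
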